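(* Let $\eta>0$ and $\epsilon\in\mathbb R$ be given scalars, let $H_1,\dots,H_N\in\mathbb R^{n\times n}$ be given matrices and $\overline u_1,\dots,\overline u_n>0$ given saturation limits. Suppose there exist a symmetric positive definite matrix $W\in\mathbb R^{n\times n}$, a diagonal positive definite matrix $V\in\mathbb R^{n\times n}$, and matrices $Z,Y,T\in\mathbb R^{n\times n}$ such that $$\begin{bmatrix} H_iZ+Z^\top H_i^\top+2\eta W & \star & \star\\ W-T^\top+\epsilon H_iZ & -\epsilon(T^\top+T) & \star\\ Z+Y-VH_i^\top & -\epsilon VH_i^\top & -2V\end{bmatrix}<0,\qquad i=1,\dots,N,$$ and $$\begin{bmatrix} W & Z_{(\ell)}^\top-Y_{(\ell)}^\top\\ \star & \overline u_\ell^2\end{bmatrix}\ge0,\qquad \ell=1,\dots,n.$$ Then, with $K=ZT^{-1}$, the origin of the average uncertain closed-loop system $$\frac{d\hat G_{\mathrm{av}}(\tau)}{d\tau}=\frac1\omega H(\alpha)K\hat G_{\mathrm{av}}(\tau)-\frac1\omega H(\alpha)\,\psi(u_{\mathrm{av}}(\tau)),\qquad u_{\mathrm{av}}=K\hat G_{\mathrm{av}},\qquad H(\alpha)=\sum_{i=1}^N\alpha_iH_i,$$ where $\omega>0$ and the constant uncertain parameter vector $\alpha$ may be any element of the unit simplex $\Lambda$, is exponentially stable.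
   Context: $\Lambda=\{\alpha\in\mathbb R^N:\sum_{i=1}^N\alpha_i=1,\ \alpha_i\ge0,\ i=1,\dots,N\}$. The unknown Hessian matrix is $H=H(\alpha)$ with known polytope vertices $H_i$. The saturation acts element-wise: $\mathrm{sat}(u)_\ell=\mathrm{sign}(u_\ell)\min(|u_\ell|,\overline u_\ell)$, and the dead-zone nonlinearity is $\psi(u)=u-\mathrm{sat}(u)$, so the system is equivalently $\frac{d\hat G_{\mathrm{av}}}{d\tau}=\frac1\omega H(\alpha)\,\mathrm{sat}(K\hat G_{\mathrm{av}})$. For a matrix $X$, $X_{(\ell)}$ is its $\ell$-th row; $\star$ denotes the block determined by symmetry; $X<0$ means symmetric negative definite and $X\ge0$ symmetric positive semidefinite. The origin is exponentially stable in the standard sense: there exist $r,c,\lambda>0$ such that $\|\hat G_{\mathrm{av}}(0)\|\le r$ implies $\|\hat G_{\mathrm{av}}(\tau)\|\le c\,e^{-\lambda\tau}\|\hat G_{\mathrm{av}}(0)\|$ for all $\tau\ge0$. *)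

(* Defs.v *)
From HB Require Import structures.
From mathcomp Require Import all_boot all_order all_algebra.
From mathcomp Require Import all_classical all_reals all_analysis.
Set Implicit Arguments.
Unset Strict Implicit.
Unset Printing Implicit Defensive.
Import Order.TTheory GRing.Theory Num.Theory.
Import numFieldNormedType.Exports.
Local Open Scope classical_set_scope.
Local Open Scope ring_scope.

Definition quad_form (R : realType) (n : nat) (X : 'M[R]_n) (x : 'cV[R]_n) : R :=
  (x^T *m X *m x) 0 0.

Definition sym_posdef (R : realType) (n : nat) (X : 'M[R]_n) : Prop :=
  X^T = X /\ forall x : 'cV[R]_n, x != 0 -> 0 < quad_form X x.

Definition sym_negdef (R : realType) (n : nat) (X : 'M[R]_n) : Prop :=
  X^T = X /\ forall x : 'cV[R]_n, x != 0 -> quad_form X x < 0.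

Definition sym_possemidef (R : realType) (n : nat) (X : 'M[R]_n) : Prop :=
  X^T = X /\ forall x : 'cV[R]_n, 0 <= quad_form X x.

(* Blocks above the diagonal are the transposes of those below it. The diagonal
   blocks are kept as given, so definiteness does require them symmetric. *)
Definition block3_lower (R : realType) (n : nat)
    (A11 A21 A22 A31 A32 A33 : 'M[R]_n) : 'M[R]_(n + (n + n)) :=
  block_mx A11 (row_mx A21^T A31^T)
           (col_mx A21 A31) (block_mx A22 A32^T A32 A33).

Definition block2_upper (R : realType) (m n : nat)
    (A11 : 'M[R]_m) (A12 : 'M[R]_(m, n)) (A22 : 'M[R]_n) : 'M[R]_(m + n) :=
  block_mx A11 A12 A12^T A22.

Definition unit_simplex (R : realType) (N : nat) : set ('I_N -> R) :=
  [set alpha | \sum_(i < N) alpha i = 1 /\ forall i, 0 <= alpha i].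

Definition polytope_mx (R : realType) (n N : nat) (H : 'I_N -> 'M[R]_n)
    (alpha : 'I_N -> R) : 'M[R]_n :=
  \sum_(i < N) alpha i *: H i.

Definition sat (R : realType) (n : nat) (ubar u : 'cV[R]_n) : 'cV[R]_n :=
  \col_l (Num.sg (u l 0) * Num.min `|u l 0| (ubar l 0)).

Definition deadzone (R : realType) (n : nat) (ubar u : 'cV[R]_n) : 'cV[R]_n :=
  u - sat ubar u.

Definition closed_loop (R : realType) (n : nat) (omega : R) (H K : 'M[R]_n)
    (ubar : 'cV[R]_n) (x : 'cV[R]_n) : 'cV[R]_n :=
  omega^-1 *: (H *m K *m x) - omega^-1 *: (H *m deadzone ubar (K *m x)).

(* The library norm on matrices is the max norm. *)
Definition norm_euclid (R : realType) (n : nat) (x : 'cV[R]_n) : R :=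
  Num.sqrt (\sum_(i < n) x i 0 ^+ 2).

(* Forward solutions of x' = f x: a function on the whole of R, of which only
   the restriction to [0, +oo[ matters. *)
Definition is_solution (R : realType) (n : nat) (f : 'cV[R]_n -> 'cV[R]_n)
    (x : R -> 'cV[R]_n) : Prop :=
  {within `[0, +oo[, continuous x} /\
  forall t : R, 0 < t -> is_derive t 1 x (f (x t)).

Definition exp_stable_origin (R : realType) (n : nat)
    (f : 'cV[R]_n -> 'cV[R]_n) : Prop :=
  exists r c lambda : R, [/\ 0 < r, 0 < c, 0 < lambda &
    forall x : R -> 'cV[R]_n, is_solution f x -> norm_euclid (x 0) <= r ->
      forall t : R, 0 <= t ->
        norm_euclid (x t) <= c * expR (- lambda * t) * norm_euclid (x 0)].

(* Main.v *)
Require Import Defs.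
From HB Require Import structures.
From mathcomp Require Import all_boot all_order all_algebra.
From mathcomp Require Import all_classical all_reals all_analysis.
From mathcomp Require Import ring lra.
Import Order.TTheory GRing.Theory Num.Theory.
Import numFieldNormedType.Exports.
Local Open Scope classical_set_scope.
Local Open Scope ring_scope.

(** The Lyapunov function is x^T P x with P = T^-T W T^-1, which in the
coordinate xi = T^-1 x is xi^T W xi.  Write the vector field as
omega^-1 T zeta, let u = K x = Z xi, and let psi = V phi be the dead zone of u.
Then T zeta = G (Z xi - V phi), where G is the uncertain matrix.

The quadratic form of the first matrix inequality at (xi, zeta, phi) is
2 times the sum of eta xi^T W xi + xi^T W zeta, of the term
(xi + epsilon zeta)^T (G (Z xi - V phi) - T zeta), which vanishes along the
dynamics, and of phi^T (Z xi + Y xi - V phi) ([lmi_formE]).  The form is affine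
in G, so its sign passes from the vertices to the whole polytope
([lmi_form_polytope]).  The last summand is the generalised sector condition for
the dead zone: it is nonnegative as soon as every entry of (Z - Y) xi stays
within the saturation level ([deadzone_sector]), and the second matrix inequality
ensures this on the ellipsoid xi^T W xi <= 1 ([possemidef_block2_bound]).  What
remains is xi^T W zeta <= - eta xi^T W xi, that is, decay of the Lyapunov function
at rate 2 eta / omega on the ellipsoid.  The first inequality also makes T
invertible: at (0, zeta, 0) its form is a multiple of zeta^T T zeta.

A quadratic Lyapunov function that decays only on its unit sublevel set still
gives local exponential stability ([exp_stable_quadratic_lyapunov]): a solution
that starts inside the open sublevel set cannot reach its boundary
([sublevel_invariant]), hence the decay estimate holds for all time
([exp_decay]).  The comparison of x^T P x with the Euclidean norm is made
algebraically: the Cauchy-Schwarz inequality for P, tested on the columns of the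
inverse of P, bounds each coordinate ([sym_posdef_lower]). *)

(** * Bilinear and quadratic forms of matrices *)

Definition bilin {R : realType} {m n : nat} (x : 'cV[R]_m) (A : 'M[R]_(m, n))
  (y : 'cV[R]_n) : R := (x^T *m A *m y) 0 0.

Section Bilin.
Context {R : realType}.

Lemma bilinT m n (x : 'cV[R]_m) (A : 'M[R]_(m, n)) (y : 'cV[R]_n) :
  bilin y A^T x = bilin x A y.
Proof. by rewrite /bilin -(trmxK x) -mulmxA -trmx_mul -trmx_mul trmxK mxE. Qed.

Lemma bilinDl m n (x y : 'cV[R]_m) (A : 'M[R]_(m, n)) z :
  bilin (x + y) A z = bilin x A z + bilin y A z.
Proof. by rewrite /bilin linearD /= !mulmxDl mxE. Qed.

Lemma bilinZl m n a (x : 'cV[R]_m) (A : 'M[R]_(m, n)) z :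
  bilin (a *: x) A z = a * bilin x A z.
Proof. by rewrite /bilin linearZ /= -!scalemxAl mxE. Qed.

Lemma bilinDr m n (x : 'cV[R]_m) (A : 'M[R]_(m, n)) y z :
  bilin x A (y + z) = bilin x A y + bilin x A z.
Proof. by rewrite /bilin mulmxDr mxE. Qed.

Lemma bilinZr m n a (x : 'cV[R]_m) (A : 'M[R]_(m, n)) y :
  bilin x A (a *: y) = a * bilin x A y.
Proof. by rewrite /bilin -scalemxAr mxE. Qed.

Lemma bilinDm m n (x : 'cV[R]_m) (A B : 'M[R]_(m, n)) y :
  bilin x (A + B) y = bilin x A y + bilin x B y.
Proof. by rewrite /bilin mulmxDr mulmxDl mxE. Qed.

Lemma bilinZm m n a (x : 'cV[R]_m) (A : 'M[R]_(m, n)) y :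
  bilin x (a *: A) y = a * bilin x A y.
Proof. by rewrite /bilin -scalemxAr -scalemxAl mxE. Qed.

Lemma bilinNm m n (x : 'cV[R]_m) (A : 'M[R]_(m, n)) y :
  bilin x (- A) y = - bilin x A y.
Proof. by rewrite -scaleN1r bilinZm mulN1r. Qed.

Lemma bilinNr m n (x : 'cV[R]_m) (A : 'M[R]_(m, n)) y :
  bilin x A (- y) = - bilin x A y.
Proof. by rewrite -scaleN1r bilinZr mulN1r. Qed.

Lemma bilinMr m n p (x : 'cV[R]_m) (A : 'M[R]_(m, n)) (B : 'M[R]_(n, p)) y :
  bilin x (A *m B) y = bilin x A (B *m y).
Proof. by rewrite /bilin !mulmxA. Qed.

Lemma bilin_sum_mx m n (I : finType) (x : 'cV[R]_m) (F : I -> 'M[R]_(m, n)) y :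
  bilin x (\sum_i F i) y = \sum_i bilin x (F i) y.
Proof. by rewrite /bilin mulmx_sumr mulmx_suml summxE. Qed.

Lemma bilin_sym n (A : 'M[R]_n) (x y : 'cV[R]_n) :
  A^T = A -> bilin x A y = bilin y A x.
Proof. by move=> sA; rewrite -bilinT sA. Qed.

Lemma bilinE m n (x : 'cV[R]_m) (A : 'M[R]_(m, n)) (y : 'cV[R]_n) :
  bilin x A y = \sum_i \sum_j x i 0 * A i j * y j 0.
Proof.
rewrite /bilin mxE exchange_big; apply: eq_bigr => j _ /=.
by rewrite mxE mulr_suml; apply: eq_bigr => i _; rewrite mxE.
Qed.

Lemma quad_formE n (A : 'M[R]_n) (x : 'cV[R]_n) :
  quad_form A x = \sum_i \sum_j x i 0 * A i j * x j 0.
Proof. exact: bilinE. Qed.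

Lemma bilin_block m n p q (A : 'M[R]_(m, p)) B C (D : 'M[R]_(n, q)) x1 x2 y1 y2 :
  bilin (col_mx x1 x2) (block_mx A B C D) (col_mx y1 y2) =
  bilin x1 A y1 + bilin x1 B y2 + (bilin x2 C y1 + bilin x2 D y2).
Proof.
rewrite /bilin tr_col_mx mul_row_block mul_row_col !mulmxDl !mxE.
by rewrite addrACA.
Qed.

Lemma bilin_row_mx m n p (A : 'M[R]_(m, n)) (B : 'M[R]_(m, p)) x y z :
  bilin x (row_mx A B) (col_mx y z) = bilin x A y + bilin x B z.
Proof. by rewrite /bilin mul_mx_row mul_row_col mxE. Qed.

Lemma bilin_col_mx m n p (A : 'M[R]_(m, p)) (B : 'M[R]_(n, p)) x y z :
  bilin (col_mx x y) (col_mx A B) z = bilin x A z + bilin y B z.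
Proof. by rewrite /bilin tr_col_mx mul_row_col mulmxDl mxE. Qed.

Lemma quad_form_block3 n (A11 A21 A22 A31 A32 A33 : 'M[R]_n) x y z :
  quad_form (block3_lower A11 A21 A22 A31 A32 A33) (col_mx x (col_mx y z)) =
  quad_form A11 x + quad_form A22 y + quad_form A33 z +
  2 * (bilin y A21 x + bilin z A31 x + bilin z A32 y).
Proof.
rewrite -[LHS]/(bilin _ _ _) /block3_lower bilin_block bilin_row_mx.
rewrite bilin_col_mx bilin_block !bilinT /quad_form -!/(bilin _ _ _); ring.
Qed.

Lemma quad_form_block2 m n (A11 : 'M[R]_m) A12 (A22 : 'M[R]_n) x y :
  quad_form (block2_upper A11 A12 A22) (col_mx x y) =
  quad_form A11 x + 2 * bilin x A12 y + quad_form A22 y.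
Proof.
rewrite -[LHS]/(bilin _ _ _) /block2_upper bilin_block !bilinT.
rewrite /quad_form -!/(bilin _ _ _); ring.
Qed.

Lemma unitmx_inj n (A : 'M[R]_n) :
  (forall x : 'cV[R]_n, A *m x = 0 -> x = 0) -> A \in unitmx.
Proof.
move=> Ainj; rewrite -unitmx_tr -row_free_unit; apply: inj_row_free => v vA0.
apply: trmx_inj; rewrite trmx0; apply: Ainj.
by rewrite -[A]trmxK -trmx_mul vA0 trmx0.
Qed.

Lemma sym_posdef_unitmx n (P : 'M[R]_n) : sym_posdef P -> P \in unitmx.
Proof.
move=> [_ P0]; apply: unitmx_inj => x Px0; apply/eqP/negPn/negP => /P0.
by rewrite /quad_form -mulmxA Px0 mulmx0 mxE ltxx.
Qed.

Lemma sym_posdef_ge0 n (P : 'M[R]_n) x : sym_posdef P -> 0 <= quad_form P x.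
Proof.
move=> [_ P0]; have [->|/P0/ltW//] := eqVneq x 0.
by rewrite /quad_form mulmx0 mxE.
Qed.

Lemma sym_posdef_congr n (P A : 'M[R]_n) :
  A \in unitmx -> sym_posdef P -> sym_posdef (A^T *m P *m A).
Proof.
move=> uA [sP P0]; split; first by rewrite !trmx_mul trmxK sP mulmxA.
move=> x x0; rewrite /quad_form -!mulmxA mulmxA -trmx_mul mulmxA.
apply: (P0 (A *m x)); apply: contra_neq x0 => Ax0.
by rewrite -(mulKmx uA x) Ax0 mulmx0.
Qed.

Lemma bilin_CauchySchwarz n (P : 'M[R]_n) x y : sym_posdef P ->
  bilin x P y ^+ 2 <= quad_form P x * quad_form P y.
Proof.
move=> Ppos; have [-> |y0] := eqVneq y 0.
  by rewrite /bilin /quad_form !mulmx0 !mxE expr0n mulr0.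
have qy : 0 < quad_form P y by case: Ppos => _; apply.
(* The form is nonnegative at the multiple q *: (x - (b / q) *: y) of the
   component of x that is P-orthogonal to y. *)
set b := bilin x P y; set q := quad_form P y in qy *.
have := sym_posdef_ge0 _ _ (q *: x + (- b) *: y) Ppos.
rewrite -[quad_form _ _]/(bilin _ _ _) !(bilinDl, bilinDr, bilinZl, bilinZr).
rewrite (bilin_sym _ _ y x); last by case: Ppos.
rewrite -/b -[bilin y P y]/q -[bilin x P x]/(quad_form P x).
set p := quad_form P x.
rewrite [X in 0 <= X](_ : _ = q * (p * q - b ^+ 2)); last by ring.
by rewrite pmulr_rge0// subr_ge0.
Qed.

(** Coercivity with an explicit constant: x_i is the P-product of x with the i-th
    column of P^-1, so the Cauchy-Schwarz inequality bounds each x_i ^+ 2 by a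
    multiple of the form, without any compactness argument. *)
Lemma sym_posdef_lower n (P : 'M[R]_n) : sym_posdef P ->
  exists2 p : R, 0 < p &
    forall x : 'cV[R]_n, \sum_i x i 0 ^+ 2 <= p * quad_form P x.
Proof.
move=> Ppos; have uP := sym_posdef_unitmx _ _ Ppos.
pose u i := invmx P *m delta_mx i 0 : 'cV[R]_n.
have u0 i : 0 <= quad_form P (u i) by exact: sym_posdef_ge0.
(* The summand 1 keeps the constant positive in dimension 0. *)
exists (1 + \sum_i quad_form P (u i)); first by rewrite ltr_pwDl// sumr_ge0.
move=> x; rewrite mulrDl mul1r -[leLHS]add0r lerD ?sym_posdef_ge0//.
rewrite mulr_suml; apply: ler_sum => i _.
have -> : x i 0 = bilin (u i) P x; last exact: bilin_CauchySchwarz.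
case: Ppos => sP _.
by rewrite /bilin trmx_mul trmx_inv sP mulmxKV// trmx_delta -rowE mxE.
Qed.

Lemma quad_form_upper n (P : 'M[R]_n) :
  exists2 q : R, 0 < q &
    forall x : 'cV[R]_n, quad_form P x <= q * \sum_i x i 0 ^+ 2.
Proof.
exists (1 + \sum_i \sum_j `|P i j|).
  by rewrite ltr_pwDl// sumr_ge0// => i _; rewrite sumr_ge0.
move=> x; set s := \sum_i x i 0 ^+ 2.
have s0 : 0 <= s by apply: sumr_ge0 => i _; exact: sqr_ge0.
have xs i : x i 0 ^+ 2 <= s.
  by rewrite /s (bigD1 i)//= lerDl sumr_ge0// => j _; exact: sqr_ge0.
rewrite quad_formE mulrDl mul1r -[leLHS]add0r lerD// mulr_suml.
apply: ler_sum => i _; rewrite mulr_suml; apply: ler_sum => j _.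
rewrite mulrAC mulrC (le_trans (ler_norm _))// normrM ler_wpM2l//.
rewrite normrM; have := xs i; have := xs j.
rewrite -(real_normK (num_real (x i 0))) -(real_normK (num_real (x j 0))).
have := sqr_ge0 (`|x i 0| - `|x j 0|); nra.
Qed.

End Bilin.

(** * Lyapunov functions along solutions *)

Section Analysis.
Context {R : realType}.

Lemma continuous_quad_form n (P : 'M[R]_n) : continuous (quad_form P).
Proof.
move=> x.
have -> : quad_form P = \sum_i \sum_j
    ((fun x : 'cV[R]_n => x i 0) * cst (P i j) * (fun x : 'cV[R]_n => x j 0)).
  apply/funext => y; rewrite quad_formE fct_sumE; apply: eq_bigr => i _.
  by rewrite fct_sumE.
have cD (F : 'I_n -> 'cV[R]_n -> R) :
    (forall i, {for x, continuous (F i)}) -> {for x, continuous (\sum_i F i)}.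
  move=> cF; elim/big_ind : _ => //; first exact: cst_continuous.
  by move=> f g cf cg; exact: continuousD.
apply: (cD) => i; apply: (cD) => j.
apply: continuousM; last exact: coord_continuous.
by apply: continuousM; [exact: coord_continuous|exact: cst_continuous].
Qed.

Lemma is_derive_quad_form n (P : 'M[R]_n) (x : R -> 'cV[R]_n) (t : R)
    (d : 'cV[R]_n) : P^T = P -> is_derive t 1 x d ->
  is_derive t 1 (fun s => quad_form P (x s)) (2 * bilin (x t) P d).
Proof.
move=> sP [dx xd].
have dxi i : is_derive t 1 (fun s => x s i 0) (d i 0).
  apply: DeriveDef; first by move/derivable_mxP : dx.
  by rewrite -xd derive_mx// mxE.
have -> : (fun s => quad_form P (x s)) = \sum_i \sum_j
    ((fun s => x s i 0) * cst (P i j) * (fun s => x s j 0)).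
  apply/funext => s; rewrite quad_formE fct_sumE; apply: eq_bigr => i _.
  by rewrite fct_sumE.
apply: is_derive_eq.
rewrite mulr_natl mulr2n {2}(bilin_sym _ _ _ _ sP) !bilinE -big_split /=.
apply: eq_bigr => i _; rewrite -big_split /=; apply: eq_bigr => j _.
rewrite scaler0 add0r fctE /= /GRing.scale /=; ring.
Qed.

(** If the level a were reached, consider the infimum s of the times at which it
    is: v does not increase before s, so v s <= v 0 < a, and by continuity v stays
    below a slightly beyond s, against the choice of s. *)
Lemma sublevel_invariant (v dv : R -> R) (a : R) :
  {within `[0, +oo[, continuous v} ->
  (forall t : R, 0 < t -> is_derive t 1 v (dv t)) ->
  (forall t, 0 < t -> v t <= a -> dv t <= 0) ->
  v 0 < a -> forall t, 0 <= t -> v t < a.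
Proof.
move=> cv v'E v'le0 v0a t1 t10; apply: contrapT => /negP; rewrite -leNgt => av1.
pose S := [set t | 0 <= t /\ a <= v t].
have S1 : S t1 by [].
have lbS : lbound S 0 by move=> t [].
have hS : has_inf S by split; [exists t1|exists 0].
pose s := inf S.
have s0 : 0 <= s by apply: lb_le_inf => //; exists t1.
have below t : 0 <= t -> t < s -> v t < a.
  move=> t0 ts; rewrite ltNge; apply/negP => avt.
  by have := ge_inf (ex_intro _ 0 lbS) (conj t0 avt : S t); rewrite leNgt ts.
have vs : v s < a.
  apply: le_lt_trans v0a.
  have itvE t : t \in `]0, s[%R -> 0 < t /\ t < s.
    by rewrite in_itv/= => /andP[].
  apply: (@ler0_derive1_le_cc _ v 0 s) => //; rewrite ?in_itv/= ?lexx ?s0//.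
  - by move=> t /itvE[t0 _]; case: (v'E t t0).
  - move=> t /itvE[t0 ts]; rewrite derive1E; case: (v'E t t0) => _ ->.
    by apply: v'le0 => //; exact/ltW/below/ts/ltW.
  - by apply: continuous_subspaceW cv; exact: subset_itvl.
move/subspace_continuousP : cv => /(_ s).
rewrite /= in_itv/= andbT => /(_ s0).
move=> /cvgr_lt/(_ _ vs)[e /= e0 near_s].
have [t [t0 avt] tse] := inf_adherent e0 hS.
have st : s <= t by apply: ge_inf => //; exists 0.
have : v t < a.
  apply: near_s; last by rewrite /= in_itv/= t0.
  by rewrite /= ler0_norm ?subr_le0// opprB ltrBlDl.
by rewrite ltNge avt.
Qed.

(** The integrating factor expR (k * t) turns the differential inequality into the
    monotonicity of expR (k * t) * v t. *)
Lemma exp_decay (v dv : R -> R) (k : R) :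
  {within `[0, +oo[, continuous v} ->
  (forall t : R, 0 < t -> is_derive t 1 v (dv t)) ->
  (forall t : R, 0 < t -> dv t <= - k * v t) ->
  forall t : R, 0 <= t -> expR (k * t) * v t <= v 0.
Proof.
move=> cv v'E v'le t t0.
pose w := (expR \o ( *%R k)) * v.
have w'E (s : R) : 0 < s -> is_derive s 1 w (expR (k * s) * (dv s + k * v s)).
  move=> s0; have v's := v'E s s0.
  have ks : is_derive s 1 ( *%R k) k.
    have -> : *%R k = k \*: (id : R -> R) by apply/funext.
    by apply: is_derive_eq; rewrite /GRing.scale /= mulr1.
  by apply: is_derive_eq; rewrite /GRing.scale /=; ring.
have -> : v 0 = w 0 by rewrite /w fctE /= mulr0 expR0 mul1r.
apply: (@ler0_derive1_nincry _ w 0) => // [s|s|].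
- by rewrite in_itv/= andbT => /w'E[].
- rewrite in_itv/= andbT => s0; rewrite derive1E.
  case: (w'E s s0) => _ ->; rewrite pmulr_rle0 ?expR_gt0//.
  by have := v'le s s0; lra.
- have ce : continuous (expR \o ( *%R k)).
    move=> s; apply: continuous_comp; last exact: continuous_expR.
    exact: mulrl_continuous.
  by move=> s; apply: continuousM; [exact: (continuous_subspaceT ce)|exact: cv].
Qed.

(** Decay is assumed on the unit sublevel set only, since saturation may destroy it
    farther out.  That suffices: solutions that start strictly inside never leave,
    so the decay estimate applies along them for all time. *)
Lemma exp_stable_quadratic_lyapunov n (f : 'cV[R]_n -> 'cV[R]_n) (P : 'M[R]_n)
    (lambda : R) : sym_posdef P -> 0 < lambda ->
  (forall x, quad_form P x <= 1 -> bilin x P (f x) <= - lambda * quad_form P x) ->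
  exp_stable_origin f.
Proof.
move=> Ppos lam0 decr.
have [p p0 lowP] := sym_posdef_lower _ _ Ppos.
have [q q0 upP] := quad_form_upper _ P.
(* The radius satisfies q * r ^+ 2 < 1, which puts the initial state strictly
   inside the unit sublevel set. *)
exists (q + 1)^-1, (Num.sqrt (p * q)), lambda; split=> //.
- by rewrite invr_gt0 addr_gt0.
- by rewrite sqrtr_gt0 mulr_gt0.
move=> x [cx x'E] x0r t t0.
set S0 := \sum_(i < n) x 0 i 0 ^+ 2.
have S00 : 0 <= S0 by apply: sumr_ge0 => i _; exact: sqr_ge0.
pose v (s : R) := quad_form P (x s).
have v01 : v 0 < 1.
  have S0r : S0 <= (q + 1)^-1 ^+ 2.
    rewrite -[S0]sqr_sqrtr// lerXn2r ?nnegrE ?sqrtr_ge0// invr_ge0 ltW//.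
    by rewrite addr_gt0.
  apply: le_lt_trans (upP _) _; apply: (@le_lt_trans _ _ (q * (q + 1)^-1 ^+ 2)).
    by rewrite ler_pM2l.
  rewrite exprVn ltr_pdivrMr ?exprn_gt0 ?addr_gt0//; nra.
have cv : {within `[0, +oo[, continuous v}.
  by move=> s; apply: continuous_comp (cx s) _; exact: continuous_quad_form.
have v'E (s : R) : 0 < s -> is_derive s 1 v (2 * bilin (x s) P (f (x s))).
  by move=> s0; apply: is_derive_quad_form; [case: Ppos|exact: x'E].
have v'le (s : R) :
    v s <= 1 -> 2 * bilin (x s) P (f (x s)) <= - (2 * lambda) * v s.
  by move=> /decr; rewrite -/(v s) => ?; lra.
have vlt1 (s : R) : 0 <= s -> v s < 1.
  apply: (sublevel_invariant _ _ _ cv v'E) => // u u0 /v'le/le_trans; apply.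
  by rewrite mulNr oppr_le0 mulr_ge0 ?sym_posdef_ge0// mulr_ge0// ltW.
have := exp_decay _ _ (2 * lambda) cv v'E _ t t0.
move=> /(_ (fun s s0 => v'le s (ltW (vlt1 s (ltW s0))))) vt.
set e := expR (- lambda * t).
have ee : expR (2 * lambda * t) * e ^+ 2 = 1.
  by rewrite expr2 /e -!expRD [X in expR X](_ : _ = 0) ?expR0//; ring.
have vte : v t <= e ^+ 2 * v 0.
  by rewrite -[leLHS]mul1r -ee mulrAC mulrC ler_wpM2l ?sqr_ge0.
rewrite /norm_euclid -/S0.
have -> : Num.sqrt (p * q) * e * Num.sqrt S0 = Num.sqrt (p * q * e ^+ 2 * S0).
  have pq0 : 0 <= p * q by exact/ltW/mulr_gt0.
  rewrite (sqrtrM S0 (mulr_ge0 pq0 (sqr_ge0 e))) (sqrtrM (e ^+ 2) pq0).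
  by rewrite sqrtr_sqr ger0_norm ?expR_ge0.
apply: ler_wsqrtr; apply: le_trans (lowP _) _.
rewrite -2!mulrA ler_pM2l//; apply: le_trans vte _.
by rewrite [leRHS]mulrCA ler_wpM2l ?sqr_ge0//; exact: upP.
Qed.

End Analysis.

(** * The dead zone and its sector condition *)

Section Saturation.
Context {R : realType}.

(** Where u_l is not saturated the dead zone vanishes.  Where u_l > ubar_l the dead
    zone is positive and w_l >= u_l - ubar_l > 0, so both factors are positive;
    the case u_l < - ubar_l is symmetric. *)
Lemma deadzone_sector n (ubar u w : 'cV[R]_n) l : 0 < ubar l 0 ->
  `|u l 0 - w l 0| <= ubar l 0 ->
  0 <= deadzone ubar u l 0 * (sat ubar u l 0 + w l 0).
Proof.
move=> ub0; rewrite ler_norml => /andP[h1 h2]; rewrite !mxE.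
set a := u l 0 in h1 h2 *; set b := w l 0 in h1 h2 *.
set c := ubar l 0 in ub0 h1 h2 *.
have [a0|a0|<-] := ltgtP 0 a.
- rewrite gtr0_sg// mul1r gtr0_norm//; have [ac|ca] := leP a c.
    by rewrite subrr mul0r.
  by apply: mulr_ge0; lra.
- rewrite ltr0_sg// ltr0_norm//; have [ac|ca] := leP (- a) c.
    by rewrite mulN1r opprK subrr mul0r.
  by apply: mulr_le0; lra.
- by rewrite sgr0 mul0r subr0 mul0r.
Qed.

(** A Schur complement: minimising the form over the scalar last coordinate, at
    - (k^T x) / b ^+ 2, leaves (k^T x) ^+ 2 <= b ^+ 2 * x^T W x. *)
Lemma possemidef_block2_bound n (W : 'M[R]_n) (k : 'cV[R]_n) (b : R) (x : 'cV[R]_n) :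
  0 < b -> sym_possemidef (block2_upper W k ((b ^+ 2)%:M : 'M[R]_1)) ->
  quad_form W x <= 1 -> `|(k^T *m x) 0 0| <= b.
Proof.
move=> b0 [_ psd] Wx1; set g := (k^T *m x) 0 0.
have := psd (col_mx x (- (g / b ^+ 2))%:M); rewrite quad_form_block2.
have -> : bilin x k (- (g / b ^+ 2))%:M = - (g / b ^+ 2) * g.
  by rewrite /bilin mul_mx_scalar mxE -(trmxK k) -trmx_mul mxE.
have -> : quad_form (b ^+ 2)%:M (- (g / b ^+ 2))%:M = g ^+ 2 / b ^+ 2 :> R.
  rewrite /quad_form tr_scalar_mx -!scalar_mxM mxE eqxx mulr1n.
  by field; rewrite gt_eqF.
rewrite [X in 0 <= X](_ : _ = quad_form W x - g ^+ 2 / b ^+ 2); last first.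
  by field; rewrite gt_eqF.
rewrite subr_ge0 => gW; have b2 : 0 < b ^+ 2 by rewrite exprn_gt0.
rewrite -(@ler_pXn2r _ 2) ?nnegrE ?(ltW b0)// real_normK ?num_real//.
rewrite -[leRHS]mul1r -ler_pdivrMr//.
exact: le_trans gW Wx1.
Qed.

End Saturation.

(** * The matrix inequality as a form along the dynamics *)

Section LMI.
Context {R : realType} {n N : nat} (eta epsilon : R) (H : 'I_N -> 'M[R]_n).
Context (W V Z Y T : 'M[R]_n).

(** The quadratic form of the first matrix inequality, regrouped so that its first
    summand is the residual of the dynamics T *m y = G *m (Z *m x - V *m z) and its
    last one is the sector term of the dead zone V *m z. *)
Definition lmi_form (G : 'M[R]_n) (x y z : 'cV[R]_n) : R :=
  2 * (bilin (x + epsilon *: y) 1%:M (G *m (Z *m x - V *m z) - T *m y)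
       + eta * quad_form W x + bilin x W y
       + bilin z 1%:M (Z *m x + Y *m x - V *m z)).

Lemma lmi_formE (G : 'M[R]_n) x y z : W^T = W -> V^T = V ->
  quad_form (block3_lower
       (G *m Z + Z^T *m G^T + (2 * eta) *: W)
       (W - T^T + epsilon *: (G *m Z))
       (- (epsilon *: (T^T + T)))
       (Z + Y - V *m G^T)
       (- (epsilon *: (V *m G^T)))
       (- (2 *: V))) (col_mx x (col_mx y z)) = lmi_form G x y z.
Proof.
move=> sW sV; rewrite quad_form_block3 /lmi_form /quad_form.
rewrite -!/(bilin _ _ _) !(bilinDm, bilinNm, bilinZm, bilinT).
rewrite -trmx_mul bilinT -[V *m G^T]trmxK trmx_mul trmxK sV !bilinT.
rewrite mulmxBr !mulmxA !(bilinDl, bilinZl, bilinDr, bilinNr) -!bilinMr !mul1mx.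
rewrite (bilin_sym _ _ x y sW); ring.
Qed.

(** The form is affine in G, so a convex combination of the vertices yields the
    same convex combination of the values. *)
Lemma lmi_form_polytope (alpha : 'I_N -> R) x y z : unit_simplex alpha ->
  lmi_form (polytope_mx H alpha) x y z =
  \sum_i alpha i * lmi_form (H i) x y z.
Proof.
move=> [alpha1 _]; pose F G := bilin (x + epsilon *: y) G (Z *m x - V *m z).
pose c := 2 * (- bilin (x + epsilon *: y) T y
       + eta * quad_form W x + bilin x W y
       + bilin z 1%:M (Z *m x + Y *m x - V *m z)).
have lE G : lmi_form G x y z = 2 * F G + c.
  rewrite /lmi_form bilinDr bilinNr -!bilinMr !mul1mx /c /F; ring.
under eq_bigr do rewrite lE mulrDr.
rewrite lE big_split /= -mulr_suml alpha1 mul1r; congr (_ + _).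
rewrite /F bilin_sum_mx mulr_sumr; apply: eq_bigr => i _.
by rewrite bilinZm mulrCA.
Qed.
End LMI.

(** * Exponential stability of the saturated loop *)

Theorem theorem3 (R : realType) (n N : nat) (eta epsilon : R)
    (H : 'I_N -> 'M[R]_n) (ubar : 'cV[R]_n)
    (heta : 0 < eta) (hubar : forall l : 'I_n, 0 < ubar l 0)
    (W V Z Y T : 'M[R]_n)
    (hW : sym_posdef W) (hVdiag : is_diag_mx V) (hV : sym_posdef V)
    (hLMI1 : forall i : 'I_N, sym_negdef (block3_lower
       (H i *m Z + Z^T *m (H i)^T + (2 * eta) *: W)
       (W - T^T + epsilon *: (H i *m Z))
       (- (epsilon *: (T^T + T)))
       (Z + Y - V *m (H i)^T)
       (- (epsilon *: (V *m (H i)^T)))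
       (- (2 *: V))))
    (hLMI2 : forall l : 'I_n, sym_possemidef (block2_upper
       W
       ((row l Z)^T - (row l Y)^T)
       ((ubar l 0 ^+ 2)%:M : 'M[R]_1))) :
  let K := Z *m invmx T in
  forall (omega : R) (alpha : 'I_N -> R), 0 < omega -> unit_simplex alpha ->
    exp_stable_origin (closed_loop omega (polytope_mx H alpha) K ubar).
Proof.
have sW : W^T = W by case: hW.
have sV : V^T = V by case: hV.
move=> K omega alpha omega0 alphaS.
pose L := lmi_form eta epsilon W V Z Y T.
have lmi_le0 x y z : L (polytope_mx H alpha) x y z <= 0.
  rewrite /L lmi_form_polytope//; apply: sumr_le0 => i _.
  rewrite mulr_ge0_le0//; first by case: alphaS.
  rewrite -lmi_formE//.
  have [->|xyz0] := eqVneq (col_mx x (col_mx y z)) 0.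
    by rewrite /quad_form mulmx0 mxE.
  by case: (hLMI1 i) => _ /(_ _ xyz0)/ltW.
(* At (0, y, 0) the form is - 2 epsilon y^T T y, which would vanish if T *m y did;
   a vertex exists because the weights sum to 1. *)
have uT : T \in unitmx.
  apply: unitmx_inj => y Ty0; apply/eqP/negPn/negP => y0.
  have [i _] : exists i : 'I_N, True.
    case: N H alpha {hLMI1 L lmi_le0} alphaS => [|m] _ alpha [a1 _]; last by exists ord0.
    by move: a1; rewrite big_ord0 => /eqP; rewrite eq_sym oner_eq0.
  have : col_mx 0 (col_mx y 0) != 0 :> 'cV[R]_(n + (n + n)).
    by apply: contra_neq y0 => /eqP; rewrite !col_mx_eq0 => /and3P[_ /eqP].
  case: (hLMI1 i) => _ /[apply]; rewrite lmi_formE// /lmi_form Ty0.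
  rewrite /bilin /quad_form !(mulmx0, subr0, trmx0, mul0mx) mxE.
  by rewrite mulr0 !addr0 mulr0 ltxx.
have V0 l : 0 < V l l.
  case: hV => _ /(_ (delta_mx l 0)).
  rewrite /quad_form -mulmxA -colE trmx_delta -rowE !mxE; apply; apply/eqP => /matrixP/(_ l 0); rewrite !mxE !eqxx /= => /eqP.
  by rewrite oner_eq0.
pose P := (invmx T)^T *m W *m invmx T.
have P0 : sym_posdef P by apply: sym_posdef_congr; rewrite ?unitmx_inv.
apply: (exp_stable_quadratic_lyapunov _ _ P (eta / omega) P0); first by rewrite divr_gt0.
move=> x; pose xi := invmx T *m x.
have -> : quad_form P x = quad_form W xi.
  by rewrite /quad_form /P /xi trmx_mul !mulmxA.
move=> Wxi1.
pose u := K *m x; pose psi := deadzone ubar u.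
(* zeta is the velocity, up to the factor omega, in the coordinate xi. *)
pose zeta := invmx T *m (polytope_mx H alpha *m (u - psi)).
pose phi := \col_l (psi l 0 / V l l).
have uE : u = Z *m xi by rewrite /u /K /xi mulmxA.
have psiE : V *m phi = psi.
  apply/colP => l; rewrite mxE (bigD1 l)//= big1 => [|k kl].
    by rewrite addr0 mxE mulrC divfK// gt_eqF.
  by move/is_diag_mxP : hVdiag => ->; rewrite ?mul0r// eq_sym.
(* V is diagonal and positive, so each term of phi^T (sat u + Y xi) is a positive
   multiple of the sector product of one coordinate. *)
have sector : 0 <= bilin phi 1%:M (Z *m xi + Y *m xi - V *m phi).
  rewrite psiE -uE addrAC subKr /bilin mulmx1 mxE; apply: sumr_ge0 => l _.
  rewrite mxE [phi l 0]mxE [(sat _ _ + _) l 0]mxE.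
  rewrite mulrAC divr_ge0 ?(ltW (V0 l))//.
  apply: deadzone_sector => //.
  have := possemidef_block2_bound _ _ _ _ _ (hubar l) (hLMI2 l) Wxi1.
  by rewrite uE linearB /= !trmxK mulmxBl -!row_mul !mxE.
have dynE : polytope_mx H alpha *m (Z *m xi - V *m phi) = T *m zeta.
  by rewrite psiE -uE /zeta mulKVmx.
have fE : closed_loop omega (polytope_mx H alpha) K ubar x =
    omega^-1 *: (T *m zeta).
  by rewrite -dynE psiE -uE /closed_loop -scalerBr -mulmxA -mulmxBr.
have -> : bilin x P (closed_loop omega (polytope_mx H alpha) K ubar x) =
    omega^-1 * bilin xi W zeta.
  rewrite fE bilinZr; congr (_ * _).
  by rewrite /P bilinMr mulKmx// /bilin trmx_mul !mulmxA.
have := lmi_le0 xi zeta phi; rewrite /L /lmi_form dynE subrr.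
rewrite [bilin _ 1%:M 0]/bilin mulmx0 mxE add0r => lmi.
rewrite -mulNr mulrC -[leRHS]mulrAC ler_pM2r ?invr_gt0//.
lra.
Qed.
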